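(* There is an absolute constant $C>0$ with the following property. Let $n\ge1$, let $\vec a=(a_0,\dots,a_n)$ be a tropical boolean vector (i.e. $a_0=a_n=0$ and $a_i\in\{0,\infty\}$ for all $i$), with tropical Hilbert function $d_{\vec a}$ and tropical entropy $H=H_{\vec a}$, and let $V$ be the number of vertices of the graph $G_{\vec a}$ (i.e. the number of weak orderings of $n$ coordinates). Then: (a) there is a positive integer $R<\exp((Cn)^n)$ such that for every integer $k>(V^2+1)(V+n)+V((1-H)V+n+1)^2$, $d_{\vec a}(k+R)=d_{\vec a}(k)+HR$; (b) there is a function $r$, periodic with an integer period less than $\exp((Cn)^n)$, such that $d_{\vec a}(k)=Hk+r(k)$ for all integers $k>n^{Cn}$.
   Context: A real sequence $(z_1,\dots,z_k)$ satisfies $\vec a$ if for every $1\le j\le k-n$ the (finite) minimum $\min_{0\le i\le n}\{z_{j+i}+a_i\}$ is attained for at least two different values of $i$; terms with $a_i=\infty$ equal $\infty$. $d_{\vec a}(k)$ is the dimension of the set (a finite union of polyhedra) of all such sequences in $\mathbb{R}^k$, and $H_{\vec a}:=\lim_{k\to\infty}d_{\vec a}(k)/k$ (the limit exists by subadditivity of $d_{\vec a}$). The vertices of $G_{\vec a}$ correspond to the nonempty polyhedra in $\mathbb{R}^n$ obtained by imposing, for each pair of coordinates $y_r,y_t$, exactly one of $y_r=y_t$, $y_r<y_t$, $y_t<y_r$. *)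

(* Defs.v *)
From HB Require Import structures.
From mathcomp Require Import all_boot all_order all_algebra.
From mathcomp Require Import all_classical all_reals all_analysis.

Set Implicit Arguments.
Unset Strict Implicit.
Unset Printing Implicit Defensive.

Import Order.TTheory GRing.Theory Num.Theory.
Import numFieldNormedType.Exports.

Local Open Scope classical_set_scope.
Local Open Scope ring_scope.

Section PolyhedralDimension.
Variables (R : realType) (k : nat).

Definition is_polyhedron (P : set 'rV[R]_k) : Prop :=
  exists (m : nat) (A : 'M[R]_(k, m)) (b : 'rV[R]_m),
    P = [set x | forall i : 'I_m, (x *m A) 0 i <= b 0 i].

(* [P] contains [d + 1] affinely independent points
   [x], [x + row 0 M], ..., [x + row (d - 1) M]. *)
Definition has_affine_frame (P : set 'rV[R]_k) (d : nat) : Prop :=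
  exists (x : 'rV[R]_k) (M : 'M[R]_(d, k)),
    [/\ P x, forall i : 'I_d, P (x + row i M) & row_free M].

(* The dimension of the affine hull of [P] (0 if [P] is empty). *)
Definition affine_dim (P : set 'rV[R]_k) : nat :=
  \max_(d < k.+1 | `[< has_affine_frame P d >]) (d : nat).

(* The dimension of a finite union of polyhedra: the largest dimension of a
   polyhedron it contains.  This does not depend on how [S] is written as a
   union of polyhedra, and is meant to be used for such (nonempty) [S] only. *)
Definition polyhedral_dim (S : set 'rV[R]_k) : nat :=
  \max_(d < k.+1 |
      `[< exists P, [/\ is_polyhedron P, P `<=` S & affine_dim P = d] >])
    (d : nat).

End PolyhedralDimension.

Section TropicalRecurrence.
Variables (R : realType) (n : nat).
Implicit Types a : 'I_n.+1 -> \bar R.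

Definition tropical_boolean a : Prop :=
  [/\ a ord0 = 0%E, a ord_max = 0%E & forall i, a i = 0%E \/ a i = +oo%E].

Definition min_attained_twice (f : 'I_n.+1 -> \bar R) : Prop :=
  let m := \big[Order.min/+oo%E]_(i < n.+1) f i in
  m \is a fin_num /\ exists i1 i2, [/\ i1 != i2, f i1 = m & f i2 = m].

Lemma window_proof k (j : 'I_(k - n)) (i : 'I_n.+1) : (j + i < k)%N.
Proof.
have := ltn_ord j; rewrite ltn_subRL => jk.
by rewrite (leq_ltn_trans _ jk)// addnC leq_add2r -ltnS.
Qed.

Definition window k (j : 'I_(k - n)) (i : 'I_n.+1) : 'I_k :=
  Ordinal (window_proof j i).

(* Indices start at 0: the windows start at [j = 0, ..., k - n - 1], and there
   are none if [k <= n]. *)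
Definition satisfies a k (z : 'rV[R]_k) : Prop :=
  forall j : 'I_(k - n),
    min_attained_twice (fun i => ((z 0 (window j i))%:E + a i)%E).

Definition tropical_hilbert a (k : nat) : nat :=
  polyhedral_dim [set z : 'rV[R]_k | satisfies a z].

(* [tropical_hilbert a] is subadditive, so this sequence does converge. *)
Definition tropical_entropy a : R :=
  limn (fun k : nat => (tropical_hilbert a k)%:R / k%:R : R).

End TropicalRecurrence.

Section Vertices.
Variables (R : realType) (n : nat).

Definition rel_of (c : option bool) (u v : R) : bool :=
  match c with
  | None => u == v
  | Some true => u < v
  | Some false => v < u
  end.

Definition order_cell (s : {ffun 'I_n * 'I_n -> option bool}) :
    set 'rV[R]_n :=
  [set y | forall r t, rel_of (s (r, t)) (y 0 r) (y 0 t)].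

(* Relations are imposed on all ordered pairs; a choice with a nonempty cell is
   determined by its values on [r < t], and distinct choices give disjoint
   cells, so this counts the nonempty cells. *)
Definition num_vertices : nat :=
  #|[pred s : {ffun 'I_n * 'I_n -> option bool} |
      `[< order_cell s !=set0 >]]|.

End Vertices.

(* Main.v *)
(* The dimension [d k] is the largest number of distinct values of a solution of
   length [k]: the closed order cone of a solution consists of solutions, and a
   generic point of a polyhedron has only the equalities valid on all of it.
   Cutting a solution into windows, [d (L + n)] is the maximal weight of a walk
   of length [L] in the graph, where the first vertex contributes its number of
   distinct values and an edge contributes 1 if the new coordinate differs from
   the [n] previous ones.  Hence [H] is the maximal mean weight [p / q] of a
   cycle.  A long optimal walk must meet a cycle of mean [H], since otherwise it
   would lose at least [1 / q] on each cycle it contains; such cycles can be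
   inserted or removed, which gives periodicity with period [V!].  Finally
   [V <= n ^ n]. *)
Require Import Defs.
From HB Require Import structures.
From mathcomp Require Import all_boot all_order all_algebra.
From mathcomp Require Import all_classical all_reals all_analysis.
From mathcomp Require Import zify ring lra.

Set Implicit Arguments.
Unset Strict Implicit.
Unset Printing Implicit Defensive.

(** * Maximal weights of walks *)

Section Walks.
Variables (T : finType) (w : T -> T -> nat).
Implicit Types (e : T -> T -> Prop) (u v x : T) (L s : nat).

Definition walk e u L s v : Prop :=
  exists p : nat -> T,
    [/\ p 0 = u, p L = v, forall i, i < L -> e (p i) (p i.+1)
      & s = \sum_(0 <= i < L) w (p i) (p i.+1)].

Lemma subwalk e (p : nat -> T) L i j :
    (forall l, l < L -> e (p l) (p l.+1)) -> i <= j <= L ->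
  walk e (p i) (j - i) (\sum_(i <= l < j) w (p l) (p l.+1)) (p j).
Proof.
move=> ep /andP[ij jL]; exists (fun l => p (i + l)); split.
- by rewrite addn0.
- by rewrite subnKC.
- by move=> l lji; rewrite addnS; apply: ep; lia.
- rewrite -{1}[i]add0n big_addn; apply: eq_bigr => l _.
  by rewrite addnC addnS.
Qed.

Lemma walk0 e u : walk e u 0 0 u.
Proof. by exists (fun=> u); split => //; rewrite big_geq. Qed.

Lemma walk_cat e u L1 s1 x L2 s2 v :
  walk e u L1 s1 x -> walk e x L2 s2 v -> walk e u (L1 + L2) (s1 + s2) v.
Proof.
move=> [p [p0 pL pe ->]] [r [r0 rL re ->]].
exists (fun i => if i < L1 then p i else r (i - L1)); split.
- by case: ltnP => //; rewrite leqn0 => /eqP L10; rewrite L10 r0 -pL L10.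
- by rewrite ltnNge leq_addr /= addKn.
- move=> i iL; case: ltnP => iL1.
    case: ltnP => iL1'; first exact: pe.
    have -> : i.+1 - L1 = 0 by lia.
    by rewrite r0 -pL (_ : L1 = i.+1); [exact: pe | lia].
  by rewrite ltnNge leqW //= subSn //; apply: re; lia.
- rewrite [RHS](big_cat_nat (n := L1)) ?leq_addr //=; congr (_ + _).
    rewrite !big_nat; apply: eq_bigr => i /= iL1; rewrite iL1.
    case: ltnP => // iL1'; have -> : i.+1 - L1 = 0 by lia.
    by rewrite r0 -pL (_ : L1 = i.+1) //; lia.
  symmetry; rewrite -{1}[L1]add0n big_addn addKn; apply: eq_bigr => i _.
  by rewrite !ltnNge leq_addl leqW ?leq_addl //= addnK -addSn addnK.
Qed.

Lemma walk_iter e x l c m : walk e x l c x -> walk e x (m * l) (m * c) x.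
Proof.
move=> xx; elim: m => [|m IHm]; first exact: walk0.
by rewrite !mulSn; apply: walk_cat IHm.
Qed.

(** Pigeonhole on the pairs (vertex, position modulo [m]) over the first [#|T| * m + 1] positions;
    [m = 1] extracts an ordinary cycle. *)
Lemma walk_repeat e u L s v m : 0 < m -> #|T| * m <= L -> walk e u L s v ->
  exists x l1 s1 l c l2 s2,
    [/\ walk e u l1 s1 x, walk e x l c x, walk e x l2 s2 v,
        L = l1 + l + l2 /\ s = s1 + c + s2
      & [/\ 0 < l, l <= #|T| * m & m %| l]].
Proof.
move=> m0 mL [p [p0 pL pe ->]].
pose f (i : 'I_(#|T| * m).+1) := (p i, Ordinal (ltn_pmod i m0)).
have /injectivePn[i0 [j0 ij0 fij0]] : ~~ injectiveb f.
  apply/negP => /injectiveP /leq_card.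
  by rewrite card_ord card_prod card_ord ltnn.
have [i [j [ij jL pij ijm]]] : exists i j : nat,
    [/\ i < j, j <= #|T| * m, p i = p j & i = j %[mod m]].
  case: fij0 => pij ijm; have := ij0; rewrite -val_eqE neq_ltn => /orP[] ij.
    by exists i0, j0; split => //; rewrite -ltnS.
  by exists j0, i0; split => //; rewrite -ltnS.
have {}mL := leq_trans jL mL.
have W := subwalk pe.
exists (p i), (i - 0), (\sum_(0 <= l < i) w (p l) (p l.+1)), (j - i),
  (\sum_(i <= l < j) w (p l) (p l.+1)), (L - j),
  (\sum_(j <= l < L) w (p l) (p l.+1)); split.
- by rewrite -p0; apply: W; lia.
- by rewrite [X in walk _ _ _ _ X]pij; apply: W; lia.
- by rewrite pij -pL; apply: W; lia.
- split; first by lia.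
  rewrite [LHS](big_cat_nat (n := j)) //=.
  by rewrite (big_cat_nat (m := 0) (n := i) (p := j)) //= ltnW.
- split; [by rewrite subn_gt0 | exact: leq_trans (leq_subr _ _) jL |].
  by rewrite -eqn_mod_dvd; [apply/eqP | exact: ltnW].
Qed.

Lemma walk_restrict e (X : T -> Prop) u L s v : walk e u L s v ->
  walk (fun x y => [/\ e x y, X x & X y]) u L s v \/
  exists x l1 s1 l2 s2, [/\ walk e u l1 s1 x, walk e x l2 s2 v,
    L = l1 + l2, s = s1 + s2 & ~ X x].
Proof.
move=> [p [p0 pL pe ->]].
have [h|/existsNP[i /not_implyP[iL iX]]] :=
  pselect (forall i, i <= L -> X (p i)).
  left; exists p; split=> // i iL; split; [exact: pe | exact/h/ltnW | exact: h].
right; exists (p i), (i - 0), (\sum_(0 <= l < i) w (p l) (p l.+1)), (L - i),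
  (\sum_(i <= l < L) w (p l) (p l.+1)).
have W := subwalk pe; split => //.
- by rewrite -p0; apply: W; lia.
- by rewrite -pL; apply: W; lia.
- by lia.
- by rewrite -big_cat_nat.
Qed.

Hypothesis w1 : forall x y, w x y <= 1.

Lemma walk_weight_le e u L s v : walk e u L s v -> s <= L.
Proof.
move=> [p [_ _ _ ->]]; rewrite -[leqRHS]subn0 -[leqRHS]muln1 -sum_nat_const_nat.
exact: leq_sum.
Qed.

(* The cycles are removed one by one from the walk until fewer than [#|T|]
   steps remain, and a step has weight at most 1. *)
Lemma walk_weight_bound e al be ga : be <= al ->
    (forall x l c, 0 < l <= #|T| -> walk e x l c x ->
       al * c + ga * l <= be * l) ->
  forall u L s v, walk e u L s v ->
    al * s + ga * L + be * #|T| <= be * L + al * #|T| + ga * #|T|.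
Proof.
move=> ba cyc u L; elim/ltn_ind: L => L IH s v W.
have [LV|VL] := ltnP L #|T|.
  have sL := walk_weight_le W.
  have : al * s <= al * L by rewrite leq_mul2l sL orbT.
  have : (al - be) * L <= (al - be) * #|T| by rewrite leq_mul2l (ltnW LV) orbT.
  have : ga * L <= ga * #|T| by rewrite leq_mul2l (ltnW LV) orbT.
  have : be * L <= al * L by rewrite leq_mul2r ba orbT.
  have : be * #|T| <= al * #|T| by rewrite leq_mul2r ba orbT.
  by rewrite !mulnBl; lia.
have := @walk_repeat e u L s v 1 isT; rewrite muln1 => /(_ VL W).
move=> [x [l1 [s1 [l [c [l2 [s2 [W1 Wx W2 [eL ->]]]]]]]]] [l0 lV _].
have cl := cyc x l c; rewrite l0 lV in cl; have {}cl := cl isT Wx.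
have lt : l1 + l2 < L by lia.
have := IH _ lt _ _ (walk_cat W1 W2); rewrite eL !mulnDr.
move: (al * #|T|) (be * #|T|) (ga * #|T|) cl => A B G; lia.
Qed.

(** Closed walks of length at most [#|T|] have finitely many means, so there is a largest one,
    [p / q]; the loop ensures that such walks exist. *)
Lemma exists_critical_cycle e : (exists x, e x x) -> exists x q p,
  [/\ 0 < q <= #|T|, p <= q, walk e x q p x &
      forall y l c, 0 < l <= #|T| -> walk e y l c y -> q * c <= p * l].
Proof.
move=> [x0 ex0].
have V0 : 0 < #|T| by apply/card_gt0P; exists x0.
pose P (i : 'I_#|T|.+1 * 'I_#|T|.+1) :=
  `[< 0 < i.1 /\ exists y, walk e y i.1 i.2 y >].
have W1 : walk e x0 1 (w x0 x0) x0.
  by exists (fun=> x0); split=> //; rewrite big_nat1.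
have lt1V : 1 < #|T|.+1 by rewrite ltnS.
have P0 : P (Ordinal lt1V, Ordinal (leq_ltn_trans (w1 x0 x0) lt1V)).
  by apply/asboolP; split => //; exists x0.
(* Means are compared over a common denominator, the factorial of [#|T|]. *)
case: (@arg_maxnP _ _ P (fun i => i.2 * ((#|T|)`! %/ i.1)) P0).
move=> [q p] /= /asboolP[/= q0 [y Wy]] max.
have qV : q <= #|T| by rewrite -ltnS.
exists y, q, p; split; [by rewrite q0 | exact: walk_weight_le Wy | by [] |].
move=> z l c /andP[l0 lV] Wz.
have cl := walk_weight_le Wz.
have lV1 : l < #|T|.+1 by rewrite ltnS.
have cV1 : c < #|T|.+1 by rewrite ltnS (leq_trans cl).
have /max /= : P (Ordinal lV1, Ordinal cV1).
  by apply/asboolP; split => //; exists z.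
have divV d : 0 < d <= #|T| -> (#|T|)`! %/ d * d = (#|T|)`!.
  by move=> ?; rewrite divnK // dvdn_fact.
have lF := divV l; rewrite l0 in lF; have {lF} := lF lV.
have qF := divV q; rewrite q0 in qF; have {qF} := qF qV.
have F0 := fact_gt0 #|T|.
move: (_ %/ q) (_ %/ l) => B A eB eA le.
rewrite -(leq_pmul2r F0) -{1}eA -eB.
have -> : q * c * (A * l) = q * l * (c * A) by ring.
have -> : p * l * (B * q) = q * l * (p * B) by ring.
by rewrite leq_mul2l le orbT.
Qed.

(** * Critical cycles and eventual periodicity of the maximal weight *)

Section Critical.
Variables (e : T -> T -> Prop) (q p : nat).
Hypotheses (q0 : 0 < q) (qV : q <= #|T|) (pq : p <= q).
Hypothesis subcritical :
  forall y l c, 0 < l <= #|T| -> walk e y l c y -> q * c <= p * l.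

(** Deleting cycles of mean at most [p / q] leaves fewer than [#|T|] steps, each exceeding the mean
    by at most [1 - p / q]. *)
Lemma walk_mean_le u L s v :
  walk e u L s v -> q * s + p * #|T| <= p * L + q * #|T|.
Proof.
have cyc x l c : 0 < l <= #|T| -> walk e x l c x -> q * c + 0 * l <= p * l.
  by move=> lV /(subcritical lV); lia.
by move/(walk_weight_bound pq cyc); lia.
Qed.

Lemma closed_walk_mean_le x l c : walk e x l c x -> q * c <= p * l.
Proof.
move=> W; rewrite leqNgt; apply/negP => lt.
(* Each turn raises [q * s - p * L] by at least 1, so [q * #|T| + 1] turns exceed the slack in
   [walk_mean_le]. *)
have := walk_mean_le (walk_iter (q * #|T|).+1 W).
have : (q * #|T|).+1 * (p * l).+1 <= (q * #|T|).+1 * (q * c).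
  by rewrite leq_mul2l.
move: (q * #|T|) (p * #|T|) => A B.
by rewrite [q * (_ * _)]mulnCA [p * (_ * _)]mulnCA mulnS; lia.
Qed.

(** Cutting only cycles of length divisible by [m] keeps the length modulo [m]; since no closed walk
    has mean above [p / q], the reduced weight [q * s - p * L] does not drop. *)
Lemma shorten_walk m u L s v : 0 < m -> walk e u L s v -> exists L' s',
  [/\ walk e u L' s' v, L' < #|T| * m, L' <= L, m %| L - L' &
      q * s + p * L' <= q * s' + p * L].
Proof.
move=> m0; elim/ltn_ind: L s => L IH s W.
have [LV|VL] := ltnP L (#|T| * m).
  by exists L, s; split; rewrite ?subnn ?dvdn0.
have [x [l1 [s1 [l [c [l2 [s2 [W1 Wx W2 [eL eS] [l0 lV ml]]]]]]]]] :=
  walk_repeat m0 VL W.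
have lt : l1 + l2 < L by lia.
have [L' [s' [W' L'V L'L mL' le]]] := IH _ lt _ (walk_cat W1 W2).
exists L', s'; split => //; first by lia.
  have -> : L - L' = (l1 + l2 - L') + l by lia.
  exact: dvdn_add.
by have := closed_walk_mean_le Wx; rewrite eL eS; lia.
Qed.

(** The bound on [l] lets one common multiple of 1, ..., [#|T|] serve as a period for all critical
    cycles. *)
Definition critical x := exists l c,
  [/\ 0 < l <= #|T|, walk e x l c x & q * c = p * l].

(* Outside the critical vertices every cycle loses at least [1 / q] with respect
   to the mean weight [p / q]. *)
Lemma noncritical_walk u L s v :
    walk (fun x y => [/\ e x y, ~ critical x & ~ critical y]) u L s v ->
  #|T| * q * s + L + #|T| * p * #|T| <= #|T| * p * L + #|T| * q * #|T| + #|T|.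
Proof.
have cyc x l c : 0 < l <= #|T| ->
    walk (fun x y => [/\ e x y, ~ critical x & ~ critical y]) x l c x ->
  #|T| * q * c + 1 * l <= #|T| * p * l.
  move=> lV [f [f0 fl fe fc]]; case/andP: (lV) => l0 lV'.
  have W : walk e x l c x by exists f; split=> // i /fe[].
  have [_ ncx _] := fe _ l0; rewrite f0 in ncx.
  have lt : q * c < p * l.
    rewrite ltn_neqAle (subcritical lV W) andbT; apply/eqP => eqc.
    by apply: ncx; exists l, c.
  rewrite -!mulnA; apply: (@leq_trans (#|T| * (q * c).+1)).
    by rewrite mulnS; lia.
  by rewrite leq_mul2l lt orbT.
move/(walk_weight_bound _ cyc); rewrite !mul1n; apply.
by rewrite leq_mul2l pq orbT.
Qed.

(** The numerical hypothesis contradicts [noncritical_walk], so the walk meets a critical vertex and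
    is cut there. *)
Lemma critical_split u L s v : walk e u L s v ->
    #|T| * p * L + #|T| * q * #|T| + #|T| <
      #|T| * q * s + L + #|T| * p * #|T| ->
  exists x l1 s1 l2 s2, [/\ walk e u l1 s1 x, walk e x l2 s2 v,
    L = l1 + l2, s = s1 + s2 & critical x].
Proof.
move=> W lt.
have [/noncritical_walk|] := walk_restrict (fun x => ~ critical x) W; first lia.
move=> [x [l1 [s1 [l2 [s2 [W1 W2 eL eS cx]]]]]].
exists x, l1, s1, l2, s2; split=> //.
exact: contrapT.
Qed.


Variables (init : T -> nat) (n : nat).
Hypothesis init_le : forall u, init u <= n.

Definition max_weight L N :=
  (exists u s v, walk e u L s v /\ N = init u + s) /\
  (forall u s v, walk e u L s v -> init u + s <= N).

Lemma max_weight_le L N : max_weight L N -> q * N <= p * L + q * (n + #|T|).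
Proof.
move=> [[u [s [v [/walk_mean_le W ->]]]] _].
have : q * init u <= q * n by rewrite leq_mul2l init_le orbT.
by rewrite !mulnDr; lia.
Qed.

Variable x0 : T.
Hypothesis cycle0 : walk e x0 q p x0.

(** Go around the critical cycle [L %/ q] times, then take [L %% q] more steps, whose weight is
    bounded below by 0. *)
Lemma max_weight_ge L N : max_weight L N -> p * L + p <= q * N + p * q.
Proof.
move=> [_ max]; have rq := ltn_pmod L q0.
have [f [f0 _ fe _]] := cycle0.
have := subwalk fe (i := 0) (j := L %% q); rewrite leq0n ltnW // => /(_ isT).
rewrite subn0 f0 => W; have := walk_cat (walk_iter (L %/ q) cycle0) W.
rewrite -divn_eq => /max; rewrite addnA => /(leq_trans (leq_addr _ _)) le.
have : q * (L %/ q * p) <= q * N.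
  by rewrite leq_mul2l (leq_trans (leq_addl _ _) le) orbT.
have : p * (L %% q).+1 <= p * q by rewrite leq_mul2l rq orbT.
have -> : q * (L %/ q * p) = p * (L %/ q * q) by ring.
by rewrite {3}(divn_eq L q) mulnS mulnDr; lia.
Qed.

Lemma insert_cycles u l1 s1 x l2 s2 v l c m :
    walk e u l1 s1 x -> walk e x l2 s2 v ->
    walk e x l c x -> walk e u (l1 + l2 + m * l) (s1 + s2 + m * c) v.
Proof.
move=> W1 W2 /(walk_iter m) Wx; have := walk_cat W1 (walk_cat Wx W2).
by rewrite -!addnA [m * l + l2]addnC [m * c + s2]addnC.
Qed.

(* Splitting an optimal walk at a critical vertex [x], a critical cycle of
   length [l] at [x] can be inserted repeatedly to gain [P] steps; conversely the two
   halves can be shortened modulo [l] without decreasing the reduced weight, and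
   refilled with copies of the cycle up to the required length. *)
Lemma max_weight_periodic P L N N' :
    (forall l, 0 < l <= #|T| -> l %| P) ->
    #|T| ^ 3 + #|T| ^ 2 * n + #|T| < L ->
    max_weight L N -> max_weight (L + P) N' -> q * N' = q * N + p * P.
Proof.
move=> divP large maxL maxLP.
(* Above the threshold an optimal walk is too heavy to avoid critical vertices: [#|T| ^ 3] pays for
   [#|T| * q * #|T|], and [#|T| ^ 2 * n] for the initial weight. *)
have split_max L' M : L <= L' -> max_weight L' M ->
    exists u x l1 s1 l2 s2 v l c,
    [/\ walk e u l1 s1 x, walk e x l2 s2 v, L' = l1 + l2,
        M = init u + (s1 + s2)
      & [/\ walk e x l c x, 0 < l <= #|T| & q * c = p * l]].
  move=> LL' maxM; have ge := max_weight_ge maxM.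
  have [[u [s [v [W eM]]]] _] := maxM.
  have [|x [l1 [s1 [l2 [s2 [W1 W2 eL es [l [c [lV Wx eqc]]]]]]]]] :=
    critical_split W.
    have iN : #|T| * (q * init u) <= #|T| * (#|T| * n).
      by rewrite leq_mul2l leq_mul ?orbT.
    have : #|T| * q * #|T| <= #|T| ^ 3.
      by rewrite expnSr leq_mul2r -mulnn leq_mul2l qV !orbT.
    have : #|T| * (p * q) <= #|T| * (p * #|T|) by rewrite !leq_mul2l qV !orbT.
    have : #|T| * (p * L' + p) <= #|T| * (q * M + p * q).
      by rewrite leq_mul2l ge orbT.
    rewrite eM !mulnDr; move: large LL' iN; rewrite -mulnn -!mulnA.
    by move: (#|T| * (#|T| * n)) => A; lia.
  by exists u, x, l1, s1, l2, s2, v, l, c; rewrite eM es.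
apply/eqP; rewrite eqn_leq; apply/andP; split; last first.
  have [u [x [l1 [s1 [l2 [s2 [v [l [c [W1 W2 eL -> [Wx lV eqc]]]]]]]]]]] :=
    split_max _ _ (leqnn _) maxL.
  have := insert_cycles (P %/ l) W1 W2 Wx.
  rewrite -eL divnK ?divP // => /maxLP.2.
  rewrite -(leq_pmul2l q0); apply: leq_trans.
  rewrite -{1}(divnK (divP _ lV)) [p * _]mulnCA -eqc.
  by rewrite !mulnDr; lia.
have [u [x [l1 [s1 [l2 [s2 [v [l [c [W1 W2 eL -> [Wx lV eqc]]]]]]]]]]] :=
  split_max _ _ (leq_addr _ _) maxLP.
have l0 : 0 < l by case/andP: lV.
have [k1 [t1 [U1 k1V k1l d1 le1]]] := shorten_walk l0 W1.
have [k2 [t2 [U2 k2V k2l d2 le2]]] := shorten_walk l0 W2.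
(* Both shortened halves have length below [#|T| * l <= #|T| ^ 2], and
   [2 * #|T| ^ 2 <= #|T| ^ 3 + #|T| < L]. *)
have kL : k1 + k2 <= L.
  have lVV : #|T| * l <= #|T| * #|T|.
    by rewrite leq_mul2l; case/andP: lV => _ ->; rewrite orbT.
  have : 2 * (#|T| * #|T|) <= #|T| ^ 3 + #|T|.
    rewrite (_ : _ + _ = #|T| * (#|T| * #|T| + 1)); last by ring.
    by rewrite mulnCA leq_mul2l; apply/orP; right; nia.
  by move: (#|T| ^ 2 * n) large => A; lia.
have dl : l %| L - (k1 + k2).
  have -> : L - (k1 + k2) = (l1 - k1) + (l2 - k2) - P by lia.
  by rewrite dvdn_sub ?dvdn_add ?divP.
have := insert_cycles ((L - (k1 + k2)) %/ l) U1 U2 Wx.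
rewrite divnK // subnKC // => /maxL.2.
rewrite -(leq_pmul2l q0) => le.
rewrite -(leq_add2r (p * P)) in le; apply: leq_trans le.
have : q * ((L - (k1 + k2)) %/ l * c) = p * (L - (k1 + k2)).
  by rewrite mulnCA eqc mulnCA divnK.
have : p * (l1 + l2) = p * (L + P) by rewrite eL.
have : p * (k1 + k2) + p * (L - (k1 + k2)) = p * L by rewrite -mulnDr subnKC.
by rewrite !mulnDr; lia.
Qed.

End Critical.
End Walks.

Import Order.TTheory GRing.Theory Num.Theory.
Import numFieldNormedType.Exports.

Local Open Scope classical_set_scope.
Local Open Scope ring_scope.

(** * Dimension and number of distinct values *)

(** Bisection: for each listed point, pass to a half of the interval that misses it. *)
Lemma exists_avoiding (R : realType) (s : seq R) (a b : R) :
  a < b -> exists2 t, a < t < b & t \notin s.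
Proof.
elim: s a b => [|c s IHs] a b ab.
  by exists ((a + b) / 2) => //; apply/andP; split; lra.
have [cm|mc] := leP c ((a + b) / 2).
  have [|t /andP[t1 t2] ts] := IHs ((a + b) / 2) b; first by lra.
  exists t; first by apply/andP; split; lra.
  by rewrite inE negb_or ts andbT; apply: contraTneq t1 => ->; rewrite -leNgt.
have [|t /andP[t1 t2] ts] := IHs a ((a + b) / 2); first by lra.
exists t; first by apply/andP; split; lra.
by rewrite inE negb_or ts andbT; apply: contraTneq t2 => ->; rewrite -leNgt ltW.
Qed.

Section Polyhedra.
Variables (R : realType) (k : nat).
Implicit Types (P S : set 'rV[R]_k) (x y z : 'rV[R]_k).

Lemma polyhedron_convex P x y (t : R) : is_polyhedron P -> 0 <= t <= 1 ->
  P x -> P y -> P ((1 - t) *: x + t *: y).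
Proof.
move=> [m [A [b ->]]] /andP[t0 t1] /= xP yP i.
rewrite mulmxDl -!scalemxAl !mxE; have := xP i; have := yP i; rewrite !mxE.
by move=> yb xb; nra.
Qed.

(** Move the current point along the segment towards the next [y]: for all but finitely many
    positions, an equality of coordinates there holds at both ends. *)
Lemma generic_point P x (s : seq 'rV[R]_k) : is_polyhedron P ->
    P x -> (forall y, y \in s -> P y) ->
  exists2 z, P z & forall i j, z 0 i = z 0 j ->
    forall y, y \in x :: s -> y 0 i = y 0 j.
Proof.
move=> polyP xP; elim: s => [_|y s IHs sP].
  by exists x => // i j ? y; rewrite inE => /eqP ->.
have [|z zP zgen] := IHs; first by move=> y' ys; apply: sP; rewrite inE ys orbT.
pose dif (v : 'rV[R]_k) (ij : 'I_k * 'I_k) := v 0 ij.1 - v 0 ij.2.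
(* The difference of two coordinates is affine in [t]; unless it is constant, it vanishes only at
   the listed quotient. *)
have [t /andP[t0 t1] tbad] := exists_avoiding
  [seq dif z ij / (dif z ij - dif y ij) | ij : 'I_k * 'I_k] (@ltr01 R).
exists ((1 - t) *: z + t *: y).
  apply: polyhedron_convex => //; first by rewrite !ltW.
  by apply: sP; rewrite inE eqxx.
move=> i j; rewrite !mxE => eqij.
have eq0 : dif z (i, j) = t * (dif z (i, j) - dif y (i, j)).
  by rewrite /dif /=; lra.
have zy : dif z (i, j) = dif y (i, j).
  apply/eqP; rewrite -subr_eq0; apply: contraNT tbad => nz.
  by apply/fintype.imageP; exists (i, j) => //; rewrite {1}eq0 mulfK.
have z0 : dif z (i, j) = 0 by rewrite eq0 zy subrr mulr0.
have {}zgen := zgen i j (subr0_eq z0).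
move=> y'; rewrite !inE => /or3P[/eqP->|/eqP->|ys].
- by apply: zgen; rewrite inE eqxx.
- by apply: subr0_eq; rewrite zy in z0.
- by apply: zgen; rewrite inE ys orbT.
Qed.

(* [#|firsts z|] is the number of distinct values of [z]. *)
Definition firsts z : {set 'I_k} :=
  [set i : 'I_k | [forall j : 'I_k, (j < i)%N ==> (z 0 j != z 0 i)]].

Lemma firsts_rep z i : exists2 j, j \in firsts z & z 0 j = z 0 i.
Proof.
case: (@arg_minnP _ i (fun j => z 0 j == z 0 i) (@nat_of_ord k) (eqxx _)).
move=> j /eqP ji jmin; exists j => //; rewrite inE; apply/forallP => l.
apply/implyP; apply: contraTN; rewrite ji => /jmin.
by rewrite leqNgt.
Qed.

Lemma firsts_inj z i j : i \in firsts z -> j \in firsts z -> z 0 i = z 0 j ->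
  i = j.
Proof.
rewrite !inE => /forallP iz /forallP jz eqz.
case: (ltngtP i j) => [lt|lt|/val_inj //].
  by have := jz i; rewrite lt eqz eqxx.
by have := iz j; rewrite lt eqz eqxx.
Qed.

(** Coordinates equal at a generic [z] are equal at every frame point, so [M] has at most as many
    distinct columns as [z] has distinct values, which bounds its rank [d]. *)
Lemma affine_frame_le P d : is_polyhedron P -> has_affine_frame P d ->
  exists2 z, P z & (d <= #|firsts z|)%N.
Proof.
move=> polyP [x [M [xP rowP freeM]]].
have [|z zP zgen] := generic_point (s := [seq x + row i M | i : 'I_d]) polyP xP.
  by move=> y /fintype.imageP[i _ ->].
exists z => //.
have colM r i j : z 0 i = z 0 j -> M r i = M r j.
  move=> /zgen zij; have := zij x; rewrite inE eqxx => /(_ isT) xij.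
  have := zij (x + row r M); rewrite inE fintype.image_f ?orbT // => /(_ isT).
  by rewrite !mxE xij => /addrI.
have [rep repP repz] : exists2 rep : 'I_k -> 'I_k,
    forall i, rep i \in firsts z & forall i, z 0 (rep i) = z 0 i.
  have [f fP] := @choice _ _ (fun i j => j \in firsts z /\ z 0 j = z 0 i)
    (fun i => let: ex_intro2 j jz ji := firsts_rep z i in
              ex_intro _ j (conj jz ji)).
  by exists f => i; case: (fP i).
(* [M1] keeps the columns at first occurrences; [Q] copies each to all places with the same value of
   [z]. *)
pose M1 : 'M[R]_(d, #|firsts z|) := \matrix_(r, c) M r (enum_val c).
pose Q : 'M[R]_(#|firsts z|, k) := \matrix_(c, l) (enum_val c == rep l)%:R.
have MQ : M = M1 *m Q.
  apply/matrixP => r l; rewrite !mxE.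
  have [c0 ec0] : exists c0 : 'I_#|firsts z|, enum_val c0 = rep l.
    by exists (enum_rank_in (repP l) (rep l)); rewrite enum_rankK_in.
  rewrite (bigD1 c0) //= !mxE ec0 eqxx mulr1 big1 ?addr0 => [|c cl].
    exact: colM.
  rewrite !mxE -ec0; case: eqP => [/enum_val_inj eqc|_]; last by rewrite mulr0.
  by rewrite eqc eqxx in cl.
move: freeM; rewrite /row_free => /eqP <-; rewrite {1}MQ.
exact: leq_trans (mxrankM_maxr _ _) (rank_leq_row _).
Qed.

Lemma polyhedral_dim_le S N : (forall z, S z -> (#|firsts z| <= N)%N) ->
  (polyhedral_dim S <= N)%N.
Proof.
move=> SN; apply/bigmax_leqP => d /asboolP[P [polyP PS <-]].
apply/bigmax_leqP => d' /asboolP /(affine_frame_le polyP)[z zP].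
by move/leq_trans; apply; apply/SN/PS.
Qed.

(** The closure of the order cell of [z]: values may merge but never swap. *)
Definition order_cone z : set 'rV[R]_k :=
  [set x | forall i j, z 0 i <= z 0 j -> x 0 i <= x 0 j].

Lemma order_cone_polyhedron z : is_polyhedron (order_cone z).
Proof.
exists #|{: 'I_k * 'I_k}|, (\matrix_(l, c) let: (i, j) := enum_val c in
  if z 0 i <= z 0 j then (l == i)%:R - (l == j)%:R else 0), 0.
have colE x c : (x *m (\matrix_(l, c) let: (i, j) := enum_val c in
    if z 0 i <= z 0 j then (l == i)%:R - (l == j)%:R else 0)) 0 c =
    let: (i, j) := enum_val c in if z 0 i <= z 0 j then x 0 i - x 0 j else 0.
  rewrite !mxE; case E: (enum_val c) => [i j].
  under eq_bigr do rewrite mxE E; case: ifP => _; last first.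
    by rewrite big1 // => l _; rewrite mulr0.
  under eq_bigr do rewrite mulrBr; rewrite big_split sumrN /=; congr (_ - _).
    rewrite (bigD1 i) //= eqxx mulr1 big1 ?addr0 // => l /negPf ->.
    by rewrite mulr0.
  rewrite (bigD1 j) //= eqxx mulr1 big1 ?addr0 // => l /negPf ->.
  by rewrite mulr0.
apply/seteqP; split => x /= xz.
  move=> c; rewrite colE mxE; case: (enum_val c) => i j.
  by case: ifP => // /xz; rewrite subr_le0.
move=> i j zij; have := xz (enum_rank (i, j)).
by rewrite colE mxE enum_rankK zij subr_le0.
Qed.

Lemma order_cone_dim z : (#|firsts z| <= affine_dim (order_cone z))%N.
Proof.
have ltk : (#|firsts z| < k.+1)%N by rewrite ltnS -[leqRHS]card_ord max_card.
apply: (bigop.bigmax_sup (Ordinal ltk)) => //; apply/asboolP.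
(* Indicators of the upper level sets of [z], which lie in the cone. *)
pose M : 'M[R]_(#|firsts z|, k) := \matrix_(c, l)
  (z 0 (enum_val c) <= z 0 l)%R%:R.
exists 0, M; split=> [i j _|c i j zij|]; first by rewrite !mxE.
  rewrite !mxE !add0r ler_nat; case: (leP (z 0 (enum_val c)) (z 0 i)) => // ci.
  by rewrite (le_trans ci).
rewrite -kermx_eq0; apply/rowV0P => u /sub_kermxP uM.
apply/rowP => c; rewrite mxE; apply/eqP/negPn/negP => uc.
(* Take the nonzero coefficient with the smallest value of [z]: at that coordinate the other
   indicators with nonzero coefficient vanish. *)
have [c0 uc0 c0min] := @arg_minP _ _ _ c (fun c => u 0 c != 0)
  (fun c => z 0 (enum_val c)) uc.
move/negP: uc0; apply; apply/eqP.
have := congr1 (fun v : 'rV_k => v 0 (enum_val c0)) uM; rewrite !mxE.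
rewrite (bigD1 c0) //= mxE lexx mulr1 big1 ?addr0 // => c1 c10.
rewrite mxE; have [->|uc1] := eqVneq (u 0 c1) 0; first by rewrite mul0r.
have := c0min c1 uc1; rewrite le_eqVlt => /orP[/eqP eqz|lt].
  have := firsts_inj (enum_valP _) (enum_valP _) eqz => /enum_val_inj eqc.
  by rewrite eqc eqxx in c10.
by rewrite leNgt lt mulr0.
Qed.

Lemma polyhedral_dim_ge S z : order_cone z `<=` S ->
  (#|firsts z| <= polyhedral_dim S)%N.
Proof.
move=> zS; apply: leq_trans (order_cone_dim z) _.
have lt : (affine_dim (order_cone z) < k.+1)%N.
  by rewrite ltnS; apply/bigmax_leqP => d _; rewrite -ltnS.
apply: (bigop.bigmax_sup (Ordinal lt)) => //; apply/asboolP.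
by exists (order_cone z); split=> //; exact: order_cone_polyhedron.
Qed.

End Polyhedra.

(** A position with [a i = +oo] never attains the finite minimum, so only the support matters and
    the comparison is between reals. *)
Lemma min_attained_twiceP (R : realType) (n : nat) (a : 'I_n.+1 -> \bar R)
    (y : 'I_n.+1 -> R) : tropical_boolean a ->
  min_attained_twice (fun i => ((y i)%:E + a i)%E) <->
  exists i1 i2, [/\ i1 != i2, a i1 = 0%E, a i2 = 0%E, y i1 = y i2 &
                    forall i, a i = 0%E -> y i1 <= y i].
Proof.
move=> [_ _ a01]; set f := fun i => _; rewrite /min_attained_twice.
set m := \big[_/_]_i _.
have fm i : (m <= f i)%E by exact: bigmin_le.
have f0 i : a i = 0%E -> f i = (y i)%:E by rewrite /f => ->; rewrite adde0.
split=> [[mfin [i1 [i2 [i12 f1 f2]]]]|[i1 [i2 [i12 a1 a2 y12 ymin]]]].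
  have a0 i : f i = m -> a i = 0%E.
    by move=> fim; case: (a01 i) => // ai; move: mfin; rewrite -fim /f ai addey.
  exists i1, i2; split; [by [] | exact: a0 | exact: a0 | |].
    by apply: EFin_inj; rewrite -!f0 ?f1 ?f2 //; exact: a0.
  by move=> i ai; rewrite -lee_fin -!f0 ?f1 //; exact: a0.
have m1 : m = f i1.
  apply/le_anti; rewrite fm /=; apply/bigmin_geP; split; first by rewrite leey.
  move=> i _; have [ai|ai] := a01 i; last by rewrite {2}/f ai addey ?leey.
  by rewrite !f0 // lee_fin; exact: ymin.
by rewrite m1 f0 //; split=> //; exists i1, i2; rewrite !f0 // y12.
Qed.

(** * Solutions as walks *)

Section Windows.
Variables (R : realType) (n : nat).
Implicit Types (y z : nat -> R) (k L : nat).

Definition row_seq k (x : 'rV[R]_k) : nat -> R :=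
  fun i => if insub i is Some j then x 0 j else 0.

Lemma row_seqE k (x : 'rV[R]_k) i (ik : (i < k)%N) :
  row_seq x i = x 0 (Ordinal ik).
Proof. by rewrite /row_seq insubT. Qed.

Lemma row_seqK k (x : 'rV[R]_k) : \row_i row_seq x i = x.
Proof. by apply/rowP => i; rewrite mxE /row_seq valK. Qed.

Definition shift_seq z j : nat -> R := fun i => z (j + i)%N.

Lemma shift0 z : shift_seq z 0 = z.
Proof. by apply/funext. Qed.

Lemma shift_shift z i j : shift_seq (shift_seq z i) j = shift_seq z (i + j).
Proof. by apply/funext => l; rewrite /shift_seq addnA. Qed.

Definition same_order m y z :=
  forall i j, (i < m)%N -> (j < m)%N -> (y i <= y j) = (z i <= z j).

Lemma same_order_eq m y z i j : same_order m y z -> (i < m)%N -> (j < m)%N ->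
  (y i == y j) = (z i == z j).
Proof. by move=> so im jm; rewrite !eq_le !so. Qed.

Definition otype y : {ffun 'I_n * 'I_n -> option bool} :=
  [ffun rt : 'I_n * 'I_n =>
     if y rt.1 == y rt.2 then None else Some (y rt.1 < y rt.2)].

Lemma otype_cell s y : order_cell s (\row_i y i) <-> s = otype y.
Proof.
split=> [ys|-> r t].
  apply/ffunP => -[r t]; rewrite ffunE /=; have := ys r t; rewrite !mxE /=.
  case: (s (r, t)) => [[|]|] /=.
  - by move=> lt; rewrite lt lt_eqF.
  - by move=> lt; rewrite gt_eqF // ltNge ltW.
  - by move=> ->.
by rewrite ffunE !mxE /=; case: (ltgtP (y r) (y t)) => //= ->; rewrite eqxx.
Qed.

Definition vertex : finType :=
  {s : {ffun 'I_n * 'I_n -> option bool} | `[< @order_cell R n s !=set0 >]}.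

Lemma card_vertex : #|vertex| = num_vertices R n.
Proof. exact: card_sig. Qed.

Lemma otype_nonempty y : `[< @order_cell R n (otype y) !=set0 >].
Proof. by apply/asboolP; exists (\row_i y i); apply/otype_cell. Qed.

Definition vtype y : vertex := exist _ (otype y) (otype_nonempty y).

Lemma vtypeP u : exists y, vtype y = u.
Proof.
case: u => s sP; have /asboolP[x xs] := sP.
exists (row_seq x); apply: val_inj; apply/esym/otype_cell.
by rewrite row_seqK.
Qed.

Lemma vtype_eq y z : vtype y = vtype z <-> same_order n y z.
Proof.
split=> [/(congr1 val) /= /ffunP yz i j im jm|so].
  have := yz (Ordinal im, Ordinal jm); rewrite !ffunE /=.
  by case: (ltgtP (y i)); case: (ltgtP (z i)).
apply: val_inj; apply/ffunP => -[r t]; rewrite !ffunE /=.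
by rewrite (same_order_eq so) //; case: ifP => //; rewrite !ltNge so.
Qed.

Definition is_new z i : bool := [forall j : 'I_i, z j != z i].

Definition num_values z k : nat := \sum_(i < k) is_new z i.

Lemma is_newP z i :
  reflect (forall j, (j < i)%N -> z j <> z i) (is_new z i).
Proof.
apply: (iffP forallP) => [h j ji|h j]; last exact/eqP/h.
by have /eqP := h (Ordinal ji).
Qed.

Lemma num_valuesS z k : num_values z k.+1 = (num_values z k + is_new z k)%N.
Proof. by rewrite /num_values big_ord_recr. Qed.

Lemma eq_is_new m y z i : same_order m y z -> (i < m)%N ->
  is_new y i = is_new z i.
Proof.
move=> so im; apply: eq_forallb => j.
by rewrite (same_order_eq so) // (ltn_trans _ im).
Qed.

Lemma eq_num_values m y z k : same_order m y z -> (k <= m)%N ->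
  num_values y k = num_values z k.
Proof.
move=> so km; apply: eq_bigr => i _.
by rewrite (eq_is_new so) // (leq_trans _ km).
Qed.

Lemma num_values_le z k : (num_values z k <= k)%N.
Proof.
rewrite -[leqRHS]card_ord -sum1_card; apply: leq_sum => i _.
exact: leq_b1.
Qed.

Lemma card_firsts k z : #|firsts (\row_(i < k) z i)| = num_values z k.
Proof.
rewrite -sum1_card big_mkcond; apply: eq_bigr => i _; rewrite inE.
suff -> : is_new z i = [forall j : 'I_k, (j < i)%N ==>
    ((\row_(i < k) z i) 0 j != (\row_(i < k) z i) 0 i)] by case: forallP.
apply/is_newP/forallP => [h j|h j ji].
  by apply/implyP => /h; rewrite !mxE => /eqP.
have := h (Ordinal (ltn_trans ji (ltn_ord i))).
by rewrite !mxE ji => /eqP.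
Qed.

(** The representative is arbitrary; the count depends only on the order. *)
Definition vertex_values (u : vertex) : nat :=
  num_values (projT1 (cid (vtypeP u))) n.

Lemma vertex_valuesE y : vertex_values (vtype y) = num_values y n.
Proof.
rewrite /vertex_values; case: cid => z /= /vtype_eq so.
exact: eq_num_values so _.
Qed.

Lemma vertex_values_le u : (vertex_values u <= n)%N.
Proof. exact: num_values_le. Qed.

(* The new coordinate can be chosen generically in the open interval cut out by
   the others, unless it is forced to be equal to one of them. *)
Lemma extend_order (x y : nat -> R) (bad : seq R) : same_order n x y ->
  exists2 t, forall i, (i < n)%N ->
      (x i <= t) = (y i <= y n) /\ (t <= x i) = (y n <= y i)
    & is_new y n -> t \notin bad.
Proof.
move=> so; have [ynew|] := boolP (is_new y n); last first.
  rewrite negb_forall => /existsP[j]; rewrite negbK => /eqP yj.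
  by exists (x j) => // i ilt; rewrite !so // yj.
pose M := 1 + \sum_(i < n) `|x i|.
have xM (i : 'I_n) : - M < x i < M.
  rewrite -ltr_norml /M (bigD1 i) //= addrCA ltrDl.
  by rewrite ltr_pwDl // sumr_ge0.
have M0 : - M < M by rewrite gtrN // ltr_pwDl // sumr_ge0.
(* [A] and [B] are the tightest bounds on the new coordinate; [- M] and [M] stand in when nothing
   lies below or above it. *)
pose A := \big[Order.max/- M]_(i < n | y i < y n) x i.
pose B := \big[Order.min/M]_(i < n | y n < y i) x i.
have AB : A < B.
  apply/bigmax_ltP; split.
    by apply/bigmin_gtP; split=> // i _; case/andP: (xM i).
  move=> i yin; apply/bigmin_gtP; split; first by case/andP: (xM i).
  by move=> j ynj; rewrite ltNge so // -ltNge (lt_trans yin).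
have [t /andP[At tB] tbad] := exists_avoiding bad AB.
exists t => // i ilt; have := elimT (is_newP _ _) ynew i ilt.
case: (ltgtP (y i) (y n)) => // lt _.
  have xt : x i < t.
    apply: le_lt_trans At.
    exact: (le_bigmax_cond _ (fun i : 'I_n => x i) (j := Ordinal ilt)).
  by rewrite (ltW xt) leNgt xt.
have tx : t < x i.
  apply: lt_le_trans tB _.
  exact: (bigmin_le_cond _ (fun i : 'I_n => x i) (j := Ordinal ilt)).
by rewrite (ltW tx) leNgt tx.
Qed.

Variable a : 'I_n.+1 -> \bar R.

Definition window_sat y : Prop := exists i1 i2 : 'I_n.+1,
  [/\ i1 != i2, a i1 = 0%E, a i2 = 0%E, y i1 = y i2
    & forall i : 'I_n.+1, a i = 0%E -> y i1 <= y i].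

Lemma window_sat_same_order y z :
  same_order n.+1 y z -> window_sat y -> window_sat z.
Proof.
move=> so [i1 [i2 [i12 a1 a2 y12 ymin]]]; exists i1, i2; split=> //.
  by apply/eqP; rewrite -(same_order_eq so) // y12.
by move=> i ai; rewrite -so //; exact: ymin.
Qed.

Definition sequence_sat z k :=
  forall j, (j + n < k)%N -> window_sat (shift_seq z j).

Lemma satisfies_row z k : tropical_boolean a ->
  satisfies a (\row_(i < k) z i) <-> sequence_sat z k.
Proof.
move=> aP; split=> [sat j jk|sat j].
  have jlt : (j < k - n)%N by rewrite ltn_subRL addnC.
  have /(min_attained_twiceP _ aP)[i1 [i2 [i12 a1 a2]]] := sat (Ordinal jlt).
  rewrite !mxE => z12 zmin; exists i1, i2; split=> // i ai.
  by have := zmin i ai; rewrite !mxE.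
apply/(min_attained_twiceP _ aP).
have [|i1 [i2 [i12 a1 a2 z12 zmin]]] := sat j.
  by have := ltn_ord j; rewrite ltn_subRL addnC.
exists i1, i2; split=> //; first by rewrite !mxE.
by move=> i ai; rewrite !mxE; exact: zmin.
Qed.

Definition edge (u v : vertex) : Prop :=
  exists y, [/\ window_sat y, vtype y = u & vtype (shift_seq y 1) = v].

(* Several orderings of [n + 1] coordinates may join the same two vertices (they
   differ in the comparison of the first coordinate with the last one); the
   weight is the largest of theirs. *)
Definition edge_weight (u v : vertex) : nat := `[< exists y,
  [/\ window_sat y, vtype y = u, vtype (shift_seq y 1) = v & is_new y n] >].

Lemma edge_weight_le1 u v : (edge_weight u v <= 1)%N.
Proof. exact: leq_b1. Qed.

(** A term new in the whole sequence is new among the last [n], so its edge has weight 1; the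
    converse can fail, whence an inequality. *)
Lemma walk_of_sequence z L : sequence_sat z (L + n) ->
  exists s, walk edge_weight edge (vtype z) L s (vtype (shift_seq z L)) /\
    (num_values z (L + n) <= vertex_values (vtype z) + s)%N.
Proof.
move=> sat; pose p i := vtype (shift_seq z i).
exists (\sum_(0 <= i < L) edge_weight (p i) (p i.+1))%N; split.
  exists p; split=> //.
  move=> i iL; exists (shift_seq z i); split=> //; first by apply: sat; lia.
  by rewrite shift_shift addn1.
rewrite vertex_valuesE; elim: L sat => [|L IHL] sat.
  by rewrite big_geq // addn0.
rewrite addSn num_valuesS big_nat_recr //= addnA; apply: leq_add.
  by apply: IHL => j jL; apply: sat; lia.
case: is_newP => // znew; rewrite /edge_weight; case: asboolP => // -[].
exists (shift_seq z L); split=> //; first by apply: sat; lia.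
  by rewrite shift_shift addn1.
by apply/is_newP => j jn; apply: znew; lia.
Qed.

(** The sequence grows by one term per edge, placed by [extend_order] to realise the ordering of a
    witness of that edge. *)
Lemma sequence_of_walk u L s v : walk edge_weight edge u L s v ->
  exists2 z, sequence_sat z (L + n) &
    (vertex_values u + s <= num_values z (L + n))%N.
Proof.
move=> [p [<- _ pe ->]].
suff [z [sat _ le]] : exists z, [/\ sequence_sat z (L + n),
    vtype (shift_seq z L) = p L &
    (vertex_values (p 0%N) + \sum_(0 <= i < L) edge_weight (p i) (p i.+1)
      <= num_values z (L + n))%N] by exists z.
elim: L pe => [|L IHL] pe.
  have [z zp] := vtypeP (p 0%N); exists z; split; first by move=> j; lia.
    by rewrite shift0.
  by rewrite big_geq // addn0 -zp vertex_valuesE.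
have [|z [sat zp le]] := IHL; first by move=> i iL; apply: pe; lia.
have [y [ysat yp yp1 ynew]] : exists y, [/\ window_sat y, vtype y = p L,
    vtype (shift_seq y 1) = p L.+1
    & (edge_weight (p L) (p L.+1) <= is_new y n)%N].
  rewrite /edge_weight; case: asboolP => [[y [? ? ? ynew]]|_].
    by exists y; rewrite ynew.
  by have [y []] := pe L (leqnn _); exists y.
have so : same_order n (shift_seq z L) y by apply/vtype_eq; rewrite zp yp.
(* All earlier terms are avoided, not just those in the window, so a term new in its window is new
   in the sequence. *)
have [t tord tnew] := extend_order [seq z i | i <- iota 0 (L + n)] so.
pose z' i := if (i < L + n)%N then z i else t.
have z'lt i : (i < L + n)%N -> z' i = z i by rewrite /z' => ->.
have z't : z' (L + n)%N = t by rewrite /z' ltnn.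
have so' : same_order n.+1 (shift_seq z' L) y.
  move=> i j; rewrite !ltnS => im jm; rewrite /shift_seq.
  have [lti|gei] := ltnP i n; have [ltj|gej] := ltnP j n.
  - by rewrite !z'lt ?ltn_add2l //; exact: so.
  - have -> : j = n by lia.
    by rewrite z't z'lt ?ltn_add2l //; case: (tord i lti).
  - have -> : i = n by lia.
    by rewrite z't z'lt ?ltn_add2l //; case: (tord j ltj).
  - have -> : i = n by lia.
    have -> : j = n by lia.
    by rewrite !lexx.
have so_z : same_order (L + n) z z' by move=> i j im jm; rewrite !z'lt.
exists z'; split.
- move=> j jL; have [->|ltj] : j = L \/ (j < L)%N by lia.
    by apply: window_sat_same_order ysat => i l im lm; rewrite so'.
  apply: (@window_sat_same_order (shift_seq z j)); last by apply: sat; lia.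
  by move=> i l im lm; apply: so_z; lia.
- rewrite -yp1; apply/vtype_eq => i j im jm.
  by rewrite /shift_seq -addn1 -!addnA; apply: so'; lia.
- rewrite big_nat_recr //= addnA addSn num_valuesS leq_add //.
    by rewrite -(eq_num_values so_z).
  apply: leq_trans ynew _; case yn: (is_new y n) => //=.
  rewrite lt0b; apply/is_newP => j jL; rewrite z't z'lt // => zjt.
  by have /negP := tnew yn; apply; rewrite -zjt map_f // mem_iota.
Qed.

Hypotheses (n0 : (0 < n)%N) (aP : tropical_boolean a).

Lemma constant_edge : edge (vtype (fun=> 0)) (vtype (fun=> 0)).
Proof.
exists (fun=> 0); split=> //; case: aP => a0 an _.
by exists ord0, ord_max; split=> //; rewrite -val_eqE /= neq_ltn n0.
Qed.

(** The order cone of a solution consists of solutions: in each window the two minimal positions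
    stay equal and minimal. *)
Lemma num_values_le_hilbert z k : sequence_sat z k ->
  (num_values z k <= tropical_hilbert a k)%N.
Proof.
move=> sat; rewrite -card_firsts; apply: polyhedral_dim_ge => x zx.
rewrite -(row_seqK x); apply/(satisfies_row _ _ aP) => j jk.
have [i1 [i2 [i12 a1 a2 z12 zmin]]] := sat j jk.
have lt (i : 'I_n.+1) : (j + i < k)%N by have := ltn_ord i; lia.
have zxE (i l : 'I_n.+1) : shift_seq z j i <= shift_seq z j l ->
    x 0 (Ordinal (lt i)) <= x 0 (Ordinal (lt l)).
  by move=> zil; apply: zx; rewrite !mxE.
have E (i : 'I_n.+1) : shift_seq (row_seq x) j i = x 0 (Ordinal (lt i)).
  exact: row_seqE.
exists i1, i2; split=> //; last by move=> i ai; rewrite !E; exact/zxE/zmin.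
by rewrite !E; apply/le_anti; rewrite !zxE // z12.
Qed.

Lemma hilbert_le k N :
    (forall z, sequence_sat z k -> (num_values z k <= N)%N) ->
  (tropical_hilbert a k <= N)%N.
Proof.
move=> zN; apply: polyhedral_dim_le => x xsat.
rewrite -(row_seqK x) card_firsts; apply/zN/(satisfies_row _ _ aP).
by rewrite row_seqK.
Qed.

Lemma hilbert_max_weight L :
  max_weight edge_weight edge vertex_values L (tropical_hilbert a (L + n)).
Proof.
have ub u s v : walk edge_weight edge u L s v ->
    (vertex_values u + s <= tropical_hilbert a (L + n))%N.
  move=> /sequence_of_walk[z sat le]; apply: leq_trans le _.
  exact: num_values_le_hilbert.
split; last exact: ub.
(* If no walk attained the dimension, all walks, hence all solutions, would stay strictly below it
   unless it is 0; but 0 is attained by the constant walk. *)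
apply: contrapT => nomax.
have lb u s v : walk edge_weight edge u L s v ->
    (vertex_values u + s <= (tropical_hilbert a (L + n)).-1)%N.
  move=> W; have := ub _ _ _ W; rewrite leq_eqVlt => /orP[/eqP eqN|]; last lia.
  by case: nomax; exists u, s, v.
have : (tropical_hilbert a (L + n) <= (tropical_hilbert a (L + n)).-1)%N.
  apply: hilbert_le => z /walk_of_sequence[s [W le]].
  exact: leq_trans le (lb _ _ _ W).
have /(@walk_iter _ _ _ _ _ _ L) : walk edge_weight edge (vtype (fun=> 0)) 1
    (edge_weight (vtype (fun=> 0)) (vtype (fun=> 0))) (vtype (fun=> 0)).
  exists (fun=> vtype (fun=> 0)); split; rewrite ?big_nat1 // => _ _.
  exact: constant_edge.
rewrite muln1 => W N0; case: nomax.
have := ub _ _ _ W => le.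
by do 3 eexists; split; [exact: W | lia].
Qed.

End Windows.

(** * Numerical bounds and periodicity *)

Section VertexCount.
Variables (R : realType) (n : nat).
Implicit Types (y z : nat -> R).

Definition rank y (i : 'I_n) : nat := #|[pred j : 'I_n | y j < y i]|.

Lemma rank_lt y i : (rank y i < n)%N.
Proof.
rewrite -[ltnRHS]card_ord; apply: proper_card; apply/fintype.properP; split.
  exact/fintype.subsetP.
by exists i => //; rewrite inE ltxx.
Qed.

Lemma rank_le y i j : (rank y i <= rank y j)%N = (y i <= y j).
Proof.
have [ij|ji] := leP (y i) (y j).
  apply: subset_leq_card; apply/fintype.subsetP => l; rewrite !inE => li.
  exact: lt_le_trans li ij.
apply/negbTE; rewrite -ltnNge; apply: proper_card; apply/fintype.properP; split.
  by apply/fintype.subsetP => l; rewrite !inE => lj; exact: lt_trans lj ji.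
by exists j; rewrite !inE ?ltxx.
Qed.

(** A weak ordering is determined by its rank function, a self-map of a set of [n] elements. *)
Lemma num_vertices_le : (num_vertices R n <= n ^ n)%N.
Proof.
pose rep (u : vertex R n) := projT1 (cid (vtypeP u)).
have repP u : vtype n (rep u) = u by rewrite /rep; case: cid.
pose f u := [ffun i => Ordinal (rank_lt (rep u) i)].
have <- : #|{ffun 'I_n -> 'I_n}| = (n ^ n)%N by rewrite card_ffun card_ord.
rewrite -card_vertex; apply: (leq_card f) => u v /ffunP fuv.
rewrite -(repP u) -(repP v); apply/vtype_eq => i j im jm.
have rE (l : 'I_n) : rank (rep u) l = rank (rep v) l.
  by have := fuv l; rewrite !ffunE => -[].
by rewrite -(rank_le _ (Ordinal im) (Ordinal jm)) !rE rank_le.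
Qed.

End VertexCount.

Section Bounds.
Local Open Scope nat_scope.

Lemma fact_le_expn m : m`! <= m ^ m.
Proof.
suff h k : k <= m -> k`! <= m ^ k by exact: h.
elim: k => // k IHk km; rewrite factS expnS leq_mul //.
exact/IHk/ltnW.
Qed.

(** With [N = n ^ n >= 2], each of the four terms is at most [N ^ 3], and [4 * N ^ 3 <= N ^ 5]. *)
Lemma transient_le n V : 1 < n -> V <= n ^ n ->
  V ^ 3 + V ^ 2 * n + V + n <= n ^ (5 * n).
Proof.
move=> n1 VN; rewrite [5 * n]mulnC expnM.
have nN : n <= n ^ n by rewrite -{1}[n]expn1 leq_exp2l // ltnW.
have N2 := leq_trans n1 nN.
move: (n ^ n) VN nN N2 => N VN nN N2.
have e1 : V ^ 3 <= N ^ 3 by rewrite leq_exp2r.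
have e2 : V ^ 2 * n <= N ^ 3 by rewrite [leqRHS]expnSr leq_mul // leq_exp2r.
have e3 : N <= N ^ 3 by rewrite -{1}[N]expn1 leq_exp2l.
have : 4 * N ^ 3 <= N ^ 5.
  by rewrite (expnD N 2 3) leq_mul // -[4]/(2 ^ 2) leq_exp2r.
move: (V ^ 3) (V ^ 2 * n) (N ^ 3) (N ^ 5) e1 e2 e3 => A B C D; lia.
Qed.

End Bounds.

(** [V! <= V ^ V <= n ^ (n * V) <= exp (n * n * V)], with exponent at most
    [n ^ 2 * n ^ n < (5 * n) ^ n] because [n < 2 ^ n]. *)
Lemma period_lt (R : realType) n V : (0 < n)%N -> (V <= n ^ n)%N ->
  V`!%:R < expR ((5%:R * n%:R) ^+ n) :> R.
Proof.
move=> n0 VN.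
have le1 : (V`! <= n ^ (n * V))%N.
  rewrite expnM; apply: leq_trans (fact_le_expn V) _.
  by case: (posnP V) => [->//|V0]; rewrite leq_exp2r.
have le2 : n%:R <= expR n%:R :> R.
  by apply: le_trans (expR_ge1Dx _); rewrite lerDr.
apply: (@le_lt_trans _ _ (expR n%:R ^+ (n * V))).
  apply: (@le_trans _ _ (n%:R ^+ (n * V))); first by rewrite -natrX ler_nat.
  by rewrite lerXn2r // ?nnegrE ?expR_ge0.
rewrite -expRM_natl ltr_expR -!natrM -natrX ltr_nat expnMn.
have le3 : (n * (n * V) <= n ^ 2 * n ^ n)%N by rewrite mulnA leq_mul2l VN orbT.
rewrite mulnC (leq_ltn_trans le3) // ltn_pmul2r ?expn_gt0 ?n0 //.
apply: (@leq_trans ((2 ^ n) ^ 2)); first by rewrite ltn_exp2r // ltn_expl.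
by rewrite -expnM mulnC expnM leq_exp2r.
Qed.

Lemma eventually_periodic (T : zmodType) (f : nat -> T) (P K : nat) :
    (0 < P)%N ->
    (forall k, (K < k)%N -> f (k + P)%N = f k) ->
  exists2 r : int -> T, periodic r P%:Z & forall k, (K < k)%N -> f k = r k%:Z.
Proof.
move=> P0 fP.
have fPm m k : (K < k)%N -> f (k + m * P)%N = f k.
  elim: m => [|m IHm] Kk; first by rewrite mul0n addn0.
  by rewrite mulSn addnCA addnC fP ?IHm // (leq_trans Kk) ?leq_addr.
(* Adding [K.+1 * P > K] lifts the residue into the range where [f] is periodic. *)
exists (fun z => f (`|(z %% P%:Z)%Z| + K.+1 * P)%N) => [z|k Kk] /=.
  by rewrite modzDr.
rewrite modz_nat absz_nat -(fPm K.+1 k Kk) {1}(divn_eq k P).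
rewrite -addnA addnC -[in RHS](fPm (k %/ P)%N) //.
by rewrite (leq_trans (leq_pmulr K.+1 P0)) ?leq_addl.
Qed.

(** * Recurrence and entropy of the tropical Hilbert function *)

Section Hilbert.
Variables (R : realType) (n : nat) (a : 'I_n.+1 -> \bar R).
Hypotheses (n0 : (0 < n)%N) (aP : tropical_boolean a).
Let d := tropical_hilbert a.
Let V := num_vertices R n.

(** Here [p / q] is the maximal cycle mean; the shift by [n] appears because a walk of length [L]
    describes [L + n] terms. *)
Lemma hilbert_recurrence : exists q p : nat,
  [/\ (0 < q <= V)%N,
      forall L, (p * L + p <= q * d (L + n) + p * q)%N,
      forall L, (q * d (L + n) <= p * L + q * (n + V))%N &
      forall P L, (forall l, (0 < l <= V)%N -> (l %| P)%N) ->
        (V ^ 3 + V ^ 2 * n + V < L)%N ->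
        (q * d (L + P + n) = q * d (L + n) + p * P)%N].
Proof.
have w1 := @edge_weight_le1 R n a.
have [|x [q [p]]] := exists_critical_cycle w1 (e := edge a).
  by eexists; exact: constant_edge.
rewrite card_vertex => -[/andP[q0 qV] pq cyc sub].
rewrite -[num_vertices R n]card_vertex in qV sub.
have maxd := hilbert_max_weight n0 aP.
have valn := @vertex_values_le R n.
exists q, p; rewrite /V /d -(card_vertex R n); split.
- by rewrite q0.
- by move=> L; exact: (max_weight_ge q0 qV pq cyc (maxd L)).
- move=> L; exact: (max_weight_le w1 q0 qV pq sub valn (maxd L)).
- move=> P L divP large.
  exact: (max_weight_periodic w1 q0 qV pq sub valn cyc divP large
    (maxd L) (maxd (L + P)%N)).
Qed.

Lemma entropyE q p C : (0 < q)%N ->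
    (forall L, (p * L + p <= q * d (L + n) + p * q)%N) ->
    (forall L, (q * d (L + n) <= p * L + C)%N) ->
  tropical_entropy a = p%:R / q%:R.
Proof.
move=> q0 lo hi; apply/cvg_lim => //; apply/cvgrPdist_le => eps eps0.
have q0R : 0 < q%:R :> R by rewrite ltr0n.
near=> k.
have k0 : 0 < k%:R :> R by rewrite ltr0n; near: k; exact: nbhs_infty_gt.
have nk : (n <= k)%N by near: k; exact: nbhs_infty_ge.
(* This constant bounds [q * d k - p * k] in absolute value: [p * q] and [C] are the slacks of [lo]
   and [hi], and [p * n] comes from the shift by [n]. *)
have large : (p * q + p * n + C)%:R / eps <= k%:R.
  by near: k; exact: nbhs_infty_ger.
have := lo (k - n)%N; have := hi (k - n)%N; rewrite subnK //.
have eqk : (p * (k - n) + p * n = p * k)%N by rewrite -mulnDr subnK.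
move=> hik lok.
have h1 : (q * d k <= p * k + (p * q + p * n + C))%N by lia.
have h2 : (p * k <= q * d k + (p * q + p * n + C))%N by lia.
move: h1 h2; rewrite -!(ler_nat R) !natrD !natrM -!natrM -!natrD => h1 h2.
rewrite -(ler_pM2r (mulr_gt0 q0R k0)).
rewrite -[q%:R * k%:R in leLHS]gtr0_norm ?mulr_gt0 // -normrM.
have -> : (p%:R / q%:R - (d k)%:R / k%:R) * (q%:R * k%:R) =
    (p * k)%:R - (q * d k)%:R :> R.
  by rewrite !natrM; field; rewrite !gt_eqF.
rewrite ler_pdivrMr // in large.
apply: (@le_trans _ _ (p * q + p * n + C)%:R).
  by move: h1 h2; rewrite !natrD ler_norml => h1 h2; apply/andP; split; lra.
apply: le_trans large _; rewrite mulrC ler_pM2l // ler_peMl ?ler1n //.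
Unshelve. all: by end_near. Qed.

(** For [n = 1] every window forces two neighbours to be equal, so solutions are constant. *)
Lemma hilbert1 k : n = 1%N -> (0 < k)%N -> d k = 1%N.
Proof.
move=> n1 k0; apply/eqP; rewrite eqn_leq; apply/andP; split.
  apply: hilbert_le => // z; case: k k0 => // k _.
  elim: k => [|k IHk] sat; first exact: num_values_le.
  rewrite num_valuesS (_ : is_new z k.+1 = false).
    by rewrite addn0; apply: IHk => j jk; apply: sat; lia.
  have [|i1 [i2 [i12 _ _ z12 _]]] := sat k; first by lia.
  apply/is_newP => new; have l1 := ltn_ord i1; have l2 := ltn_ord i2.
  have ne : (i1 : nat) <> i2 by move/val_inj; exact/eqP.
  move: z12; rewrite /shift_seq.
  have [[-> ->]|[-> ->]] : (i1 = 0 :> nat /\ i2 = 1 :> nat)%N \/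
      (i1 = 1 :> nat /\ i2 = 0 :> nat)%N by lia.
    by rewrite addn0 addn1 => /new; apply.
  by rewrite addn0 addn1 => /esym/new; apply.
have : sequence_sat a (fun=> 0) k.
  move=> j _; case: aP => a0 an _; exists ord0, ord_max; split => //.
  by rewrite -val_eqE /= n1.
move/(num_values_le_hilbert n0 aP); apply: leq_trans.
case: k k0 => // k _; rewrite /num_values big_ord_recl.
by rewrite (_ : is_new _ _) //; apply/is_newP.
Qed.

End Hilbert.

Theorem corollary6p8 (R : realType) :
  exists C : R, 0 < C /\
  forall (n : nat) (a : 'I_n.+1 -> \bar R),
    (1 <= n)%N -> tropical_boolean a ->
    let d : nat -> nat := tropical_hilbert a in
    let H : R := tropical_entropy a in
    let V : R := (num_vertices R n)%:R in
    (exists P : nat,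
       [/\ (0 < P)%N,
           P%:R < expR ((C * n%:R) ^+ n) &
           forall k : nat,
             (V ^+ 2 + 1) * (V + n%:R)
               + V * ((1 - H) * V + n%:R + 1) ^+ 2 < k%:R ->
             (d (k + P)%N)%:R = (d k)%:R + H * P%:R])
    /\
    (exists (r : int -> R) (T : nat),
       [/\ (0 < T)%N,
           T%:R < expR ((C * n%:R) ^+ n),
           periodic r T%:Z &
           forall k : nat,
             n%:R `^ (C * n%:R) < k%:R ->
             (d k)%:R = H * k%:R + r k%:Z]).
Proof.
(* The exponent in [transient_le], which also suffices in [period_lt]. *)
exists 5%:R; split; first by rewrite ltr0n.
move=> n a n0 aP d H V.
have VN := num_vertices_le R n.
have [q [p [/andP[q0 qV] lo hi per]]] := hilbert_recurrence n0 aP.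
have HE : H = p%:R / q%:R := entropyE n0 q0 lo hi.
(* A multiple of the length of every critical cycle. *)
pose P := (num_vertices R n)`!.
have PE := period_lt R n0 VN.
(* The expansion of [(V ^ 2 + 1) * (V + n)], the first summand of the bound in (a); the second is
   nonnegative. *)
pose K :=
  (num_vertices R n ^ 3 + num_vertices R n ^ 2 * n + num_vertices R n + n)%N.
have perK k : (K < k)%N -> (d (k + P)%N)%:R = (d k)%:R + H * P%:R.
  move=> Kk.
  have nk : (n <= k)%N by rewrite ltnW // (leq_ltn_trans _ Kk) ?leq_addl.
  have := per P (k - n)%N (fun l lV => dvdn_fact lV).
  rewrite ltn_subRL addnC => /(_ Kk); rewrite addnAC subnK //.
  move/(congr1 (fun m : nat => m%:R : R)); rewrite natrD !natrM => e.
  apply: (@mulfI _ q%:R); first by rewrite pnatr_eq0 -lt0n.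
  by rewrite e HE mulrDr; congr (_ + _); field; rewrite pnatr_eq0 -lt0n.
split.
  exists P; split=> //; first exact: fact_gt0.
  move=> k large; apply: perK; rewrite -(ltr_nat R); apply: le_lt_trans large.
  rewrite (_ : K%:R = (V ^+ 2 + 1) * (V + n%:R)).
    by rewrite lerDl mulr_ge0 ?sqr_ge0.
  by rewrite /K !natrD natrM !natrX -/V; ring.
(* For [n = 1] the bound [n ^ (5 * n)] is 1, below [K], so the constant function [d] is treated
   directly. *)
have [n1|n1] := eqVneq n 1%N.
  have d1 k : (0 < k)%N -> d k = 1%N by exact: hilbert1.
  have p0 : p = 0%N.
    (* At this length [lo] reads [2 * p * q + p <= q + p * q], impossible for [p >= 1]. *)
    by have := lo (2 * q)%N; rewrite -/d d1 ?addn_gt0 ?n0 ?orbT //; nia.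
  exists (fun=> 1), 1%N; split=> //.
    by rewrite expR_gt1 exprn_gt0 // mulr_gt0 ?ltr0n.
  move=> k; rewrite n1 powR1 ltr1n => k1; rewrite d1 ?(ltnW k1) //.
  by rewrite HE p0 !mul0r add0r.
have [|r rP rE] := @eventually_periodic R (fun k => (d k)%:R - H * k%:R) P K
  (fact_gt0 _).
  by move=> k /perK ->; rewrite natrD; ring.
exists r, P; split=> //; first exact: fact_gt0.
move=> k; rewrite -natrM powR_mulrn // -natrX ltr_nat => large.
rewrite -rE; first by ring.
apply: leq_ltn_trans large; apply: transient_le => //.
by rewrite ltn_neqAle eq_sym n1.
Qed.
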